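(* Let $(X,T)$ be a dynamical system that is distal and null. Then $(X,T)$ is equicontinuous.
   Context: A dynamical system $(X,T)$ is a compact metric space $(X,d)$ with a continuous map $T:X\to X$. A pair $(x,y)$ is proximal if $\inf_{n\ge1}d(T^nx,T^ny)=0$; $(X,T)$ is distal if the only proximal pairs are $(x,x)$. $(X,T)$ is equicontinuous if $\{T^n:n\ge0\}$ is an equicontinuous family. For an increasing sequence $A=\{0\le t_1<t_2<\cdots\}\subseteq\mathbb{Z}_+$ and a finite open cover $\mathcal U$, $h^A_{top}(T,\mathcal U)=\limsup_{n\to\infty}\frac1n\log N(\bigvee_{i=1}^nT^{-t_i}\mathcal U)$, where $N(\cdot)$ is the minimal cardinality of a subcover, and $h^A_{top}(T)=\sup_{\mathcal U}h^A_{top}(T,\mathcal U)$. $(X,T)$ is null if $h^A_{top}(T)=0$ for every increasing sequence $A$. *)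

(* Defs.v *)
From Stdlib Require Import Reals Lra List ClassicalEpsilon.
Open Scope R_scope.

Definition is_metric {X : Type} (d : X -> X -> R) : Prop :=
  (forall x y, 0 <= d x y) /\
  (forall x y, d x y = 0 <-> x = y) /\
  (forall x y, d x y = d y x) /\
  (forall x y z, d x z <= d x y + d y z).

Definition is_open {X : Type} (d : X -> X -> R) (V : X -> Prop) : Prop :=
  forall x, V x -> exists r, 0 < r /\ forall y, d x y < r -> V y.

Definition compact {X : Type} (d : X -> X -> R) : Prop :=
  forall (I : Type) (V : I -> X -> Prop),
    (forall i, is_open d (V i)) -> (forall x, exists i, V i x) ->
    exists l : list I, forall x, exists i, In i l /\ V i x.

Definition continuous_map {X : Type} (d : X -> X -> R) (T : X -> X) : Prop :=
  forall x eps, 0 < eps -> exists delta, 0 < delta /\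
    forall y, d x y < delta -> d (T x) (T y) < eps.

Definition dynamical_system {X : Type} (d : X -> X -> R) (T : X -> X) : Prop :=
  is_metric d /\ compact d /\ continuous_map d T.

Definition iterate {X : Type} (T : X -> X) (n : nat) (x : X) : X := Nat.iter n T x.

(** inf_{n>=1} d(T^n x, T^n y) = 0 (distances are nonnegative). *)
Definition proximal {X : Type} (d : X -> X -> R) (T : X -> X) (x y : X) : Prop :=
  forall eps, 0 < eps -> exists n, (1 <= n)%nat /\
    d (iterate T n x) (iterate T n y) < eps.

Definition distal {X : Type} (d : X -> X -> R) (T : X -> X) : Prop :=
  forall x y, proximal d T x y -> x = y.

Definition equicontinuous {X : Type} (d : X -> X -> R) (T : X -> X) : Prop :=
  forall eps, 0 < eps -> exists delta, 0 < delta /\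
    forall x y, d x y < delta -> forall n, d (iterate T n x) (iterate T n y) < eps.

Definition finite_open_cover {X : Type} (d : X -> X -> R) (U : list (X -> Prop)) : Prop :=
  (forall V, In V U -> is_open d V) /\ (forall x, exists V, In V U /\ V x).

Definition increasing_seq (t : nat -> nat) : Prop := forall i, (t i < t (S i))%nat.

(** The elements of the join \/_{i<n} T^{-t_i} U are the sets
    {x | forall i < n, c i (T^{t_i} x)} with c i in U.
    [join_subcover_card d T U t n k]: k elements of the join cover X. *)
Definition join_subcover_card {X : Type} (T : X -> X) (U : list (X -> Prop))
    (t : nat -> nat) (n k : nat) : Prop :=
  exists cs : list (nat -> X -> Prop),
    length cs = k /\
    (forall c, In c cs -> forall i, (i < n)%nat -> In (c i) U) /\
    (forall x, exists c, In c cs /\ forall i, (i < n)%nat -> c i (iterate T (t i) x)).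

Definition is_min_nat (P : nat -> Prop) (k : nat) : Prop :=
  P k /\ forall j, P j -> (k <= j)%nat.

Definition N_join {X : Type} (T : X -> X) (U : list (X -> Prop)) (t : nat -> nat) (n : nat) : nat :=
  epsilon (inhabits 0%nat) (is_min_nat (join_subcover_card T U t n)).

Definition limsup_eq (u : nat -> R) (l : R) : Prop :=
  (forall eps, 0 < eps -> exists N, forall n, (N <= n)%nat -> u n <= l + eps) /\
  (forall eps, 0 < eps -> forall N, exists n, (N <= n)%nat /\ l - eps <= u n).

Definition seq_entropy_cover_zero {X : Type} (T : X -> X) (t : nat -> nat) (U : list (X -> Prop)) : Prop :=
  limsup_eq (fun n => ln (INR (N_join T U t n)) / INR n) 0.

(** h^A_top(T) = sup_U h^A_top(T,U) = 0; since each h^A_top(T,U) >= 0 this means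
    h^A_top(T,U) = 0 for every finite open cover U. *)
Definition seq_entropy_zero {X : Type} (d : X -> X -> R) (T : X -> X) (t : nat -> nat) : Prop :=
  forall U, finite_open_cover d U -> seq_entropy_cover_zero T t U.

Definition null {X : Type} (d : X -> X -> R) (T : X -> X) : Prop :=
  forall t, increasing_seq t -> seq_entropy_zero d T t.

(* Main.v *)
(* The key point is that a distal system that is not equicontinuous at [x] has "toggles":
   there is [y] distinct from [x] such that for every finite set [F] some iterate of T is
   almost the identity on [F] but moves a point very close to [x] close to [y]. To get one,
   take [x_k] tending to [x] and times [n_k] separating [x_k] from [x], and compose [T^(n_k)]
   with an iterate that undoes its limit; the latter exists because the Ellis semigroup of a
   distal system is a group, which is used here in the form that an idempotent ultrafilter
   extending a suitable left ideal acts as the identity. Toggles chosen successively hardly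
   interfere with each other, so sums of toggle times realize all 0-1 patterns of visits to
   neighbourhoods of [x] and [y]: this gives arbitrarily long independence sets, and
   concatenating blocks of length [2^b] of them a sequence of positive entropy. *)
Require Import Defs.
From Stdlib Require Import Reals.
From Stdlib Require Import Lra Lia List Arith Wf_nat.
From Stdlib Require Import ClassicalEpsilon ProofIrrelevance.
From Stdlib Require Import FunctionalExtensionality PropExtensionality.
From mathcomp Require classical_sets.

(** * Idempotent ultrafilters on the natural numbers *)

Definition family := (nat -> Prop) -> Prop.

Definition subfamily (F G : family) : Prop := forall A, F A -> G A.

Record is_filter (F : family) : Prop := {
  filter_full : F (fun _ => True);
  filter_mono : forall A B : nat -> Prop, (forall n, A n -> B n) -> F A -> F B;
  filter_inter : forall A B, F A -> F B -> F (fun n => A n /\ B n);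
  filter_proper : ~ F (fun _ => False) }.

Definition ultrafilter (F : family) : Prop :=
  is_filter F /\ forall A, F A \/ F (fun n => ~ A n).

Definition shift (A : nat -> Prop) (n : nat) : nat -> Prop := fun m => A (n + m)%nat.

(** On ultrafilters this is addition in the Stone-Cech compactification of [nat]: limits along
    [conv F G] are iterated limits, the inner one along [G], the outer one along [F]. *)
Definition conv (F G : family) : family := fun A => F (fun n => G (shift A n)).

(* A filter with [F] included in [conv F F] is the filter of a closed
   subsemigroup of the Stone-Cech compactification of nat. *)
Definition idempotent_filter (F : family) : Prop :=
  is_filter F /\ subfamily F (conv F F).

Lemma filter_nonempty F A : is_filter F -> F A -> exists n, A n.
Proof.
  intros HF HA. apply NNPP. intro H. apply (filter_proper _ HF).
  apply (filter_mono _ HF A); [|exact HA]. intros n Hn. apply H. now exists n.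
Qed.

Lemma filter_forall_mem F A (Y : Type) (l : list Y) (P : Y -> nat -> Prop) :
  is_filter F -> F A -> (forall y, In y l -> F (P y)) ->
  F (fun n => A n /\ forall y, In y l -> P y n).
Proof.
  intros HF HA. induction l as [|y l IH]; intro H.
  - apply (filter_mono _ HF A); [|exact HA]. intros n Hn. split; [exact Hn|intros y []].
  - apply (filter_mono _ HF (fun n => P y n /\ (A n /\ forall y, In y l -> P y n))).
    + intros n [H1 [H2 H3]]. split; [exact H2|]. intros y' [<-|Hy']; auto.
    + apply (filter_inter _ HF); [apply H; now left|].
      apply IH. intros y' Hy'. apply H. now right.
Qed.

Lemma ultrafilter_not F A : ultrafilter F -> ~ F A -> F (fun n => ~ A n).
Proof. intros [_ HF] H. destruct (HF A); tauto. Qed.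

(** Excluded middle turns an order in [Prop] into the Boolean relation that [classical_sets.Zorn]
    expects. *)
Lemma zorn_prop (D : Type) (R : D -> D -> Prop) :
  (forall x, R x x) -> (forall x y z, R x y -> R y z -> R x z) ->
  (forall x y, R x y -> R y x -> x = y) ->
  (forall C : D -> Prop, (forall x y, C x -> C y -> R x y \/ R y x) ->
     exists z, forall x, C x -> R x z) ->
  exists z, forall x, R z x -> x = z.
Proof.
  intros Hrefl Htrans Hanti Hchain.
  pose (Rb := fun x y => if excluded_middle_informative (R x y) then true else false).
  assert (HR : forall x y, Rb x y = true <-> R x y).
  { intros x y. unfold Rb. destruct (excluded_middle_informative (R x y)); split; easy. }
  destruct (@classical_sets.Zorn D Rb) as [z Hz].
  - intro x. apply HR, Hrefl.
  - intros x y z H1 H2. apply HR. apply HR in H1, H2. eauto.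
  - intros x y H1 H2. apply HR in H1, H2. auto.
  - intros C HC. destruct (Hchain C) as [z Hz].
    + intros x y Hx Hy. destruct (HC x y Hx Hy) as [H|H]; apply HR in H; auto.
    + exists z. intros x Hx. apply HR; auto.
  - exists z. intros x Hx. apply Hz, HR, Hx.
Qed.

(** Zorn's lemma on the families above [F0] with [P], ordered by inclusion: unions bound the
    nonempty chains and [F0] bounds the empty one. *)
Lemma maximal_extension (P : family -> Prop) (F0 : family) :
  P F0 ->
  (forall C : family -> Prop, (exists F, C F) -> (forall F, C F -> P F) ->
     (forall F G, C F -> C G -> subfamily F G \/ subfamily G F) ->
     P (fun A => exists F, C F /\ F A)) ->
  exists F, P F /\ subfamily F0 F /\ forall G, P G -> subfamily F G -> subfamily G F.
Proof.
  intros HF0 Hchain.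
  pose (D := {F : family | P F /\ subfamily F0 F}).
  assert (Hself : P F0 /\ subfamily F0 F0) by (split; [exact HF0|intros A HA; exact HA]).
  destruct (zorn_prop D (fun F G => subfamily (proj1_sig F) (proj1_sig G)))
    as [[F [HF HF1]] Hmax].
  - intros F A HA; exact HA.
  - intros F G K H1 H2 A HA. apply H2, H1, HA.
  - intros [F HF] [G HG] H1 H2. simpl in *.
    assert (E : F = G).
    { apply functional_extensionality; intro A.
      apply propositional_extensionality; split; [apply H1|apply H2]. }
    subst G. now rewrite (proof_irrelevance _ HF HG).
  - intros C HC.
    destruct (classic (exists F, C F)) as [[K HK]|Hno].
    + pose (C' := fun F => exists H, C (exist _ F H)).
      assert (HU : P (fun A => exists F, C' F /\ F A)).
      { apply Hchain.
        - destruct K as [K HK0]. exists K. now exists HK0.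
        - intros F [[H1 _] _]. exact H1.
        - intros F G [H1 H1'] [H2 H2'].
          destruct (HC _ _ H1' H2') as [H|H]; simpl in H; auto. }
      assert (HU2 : subfamily F0 (fun A => exists F, C' F /\ F A)).
      { intros A HA. destruct K as [K [HK0 HK1]]. exists K.
        split; [now exists (conj HK0 HK1)|apply HK1, HA]. }
      exists (exist (fun F => P F /\ subfamily F0 F) _ (conj HU HU2)). intros [G HG] HCG A HA. simpl in *.
      exists G. split; [now exists HG|exact HA].
    + exists (exist _ F0 Hself). intros G HG. destruct Hno. now exists G.
  - exists F. split; [exact HF|]. split; [exact HF1|]. intros G HG HFG.
    assert (HG1 : P G /\ subfamily F0 G).
    { split; [exact HG|]. intros A HA. apply HFG, HF1, HA. }
    specialize (Hmax (exist _ G HG1) HFG). inversion Hmax. intros A HA; exact HA.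
Qed.

Lemma chain_union_filter (C : family -> Prop) :
  (exists F, C F) -> (forall F, C F -> is_filter F) ->
  (forall F G, C F -> C G -> subfamily F G \/ subfamily G F) ->
  is_filter (fun A => exists F, C F /\ F A).
Proof.
  intros [K HK] HC Hchain. split.
  - exists K. split; [exact HK|]. apply filter_full; auto.
  - intros A B HAB [F [HF HA]]. exists F. split; [exact HF|].
    apply (filter_mono _ (HC _ HF) A); auto.
  - intros A B [F [HF HA]] [G [HG HB]].
    destruct (Hchain F G HF HG) as [H|H].
    + exists G. split; [exact HG|]. apply filter_inter; auto.
    + exists F. split; [exact HF|]. apply filter_inter; auto.
  - intros [F [HF H]]. now apply (filter_proper _ (HC _ HF)).
Qed.

Lemma ultrafilter_extension F0 :
  is_filter F0 -> exists F, ultrafilter F /\ subfamily F0 F.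
Proof.
  intro HF0.
  destruct (maximal_extension is_filter F0 HF0 chain_union_filter) as [F [HF [H0 Hmax]]].
  exists F. split; [|exact H0]. split; [exact HF|]. intro A.
  destruct (classic (F A)) as [HA|HA]; [now left|right].
  (* The filter generated by [F] and the complement of [A], proper because [A] is not in [F]. *)
  apply (Hmax (fun B => F (fun n => ~ A n -> B n))).
  - split.
    + apply (filter_mono _ HF _ _ (fun n _ _ => I) (filter_full _ HF)).
    + intros B B' H. apply (filter_mono _ HF). intros n H1 H2. auto.
    + intros B B' H1 H2.
      apply (filter_mono _ HF) with (2 := filter_inter _ HF _ _ H1 H2). intros n; tauto.
    + intro H. apply HA. apply (filter_mono _ HF) with (2 := H). intros n Hn. now apply NNPP.
  - intros B. apply (filter_mono _ HF). auto.
  - apply (filter_mono _ HF) with (2 := filter_full _ HF). auto.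
Qed.

(* The Ellis-Numakura argument in terms of filters: [conv F p] and the [F'] below are
   the filters of the closed semigroups [S * p] and [{q in S | q * p = p}]. *)
Lemma maximal_idempotent_filter_ultra F :
  idempotent_filter F ->
  (forall G, idempotent_filter G -> subfamily F G -> subfamily G F) ->
  ultrafilter F.
Proof.
  intros [HF HFF] Hmax.
  destruct (ultrafilter_extension F HF) as [p [Hpu HFp]].
  pose proof Hpu as [Hp _].
  assert (Hsub : subfamily F (conv F p)).
  { intros A HA. apply (filter_mono _ HF) with (2 := HFF _ HA). intro n. apply HFp. }
  (* Maximality of [F] is minimality of its semigroup [S], so the subsemigroup [S * p] is all of
     [S]. *)
  assert (Hconv : subfamily (conv F p) F).
  { apply Hmax; [|exact Hsub]. split.
    - unfold conv. split.
      + apply (filter_mono _ HF) with (2 := filter_full _ HF). intros n _.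
        apply (filter_full _ Hp).
      + intros A B H. apply (filter_mono _ HF). intro n.
        apply (filter_mono _ Hp). intro m. apply H.
      + intros A B HA HB.
        apply (filter_mono _ HF) with (2 := filter_inter _ HF _ _ HA HB).
        intros n [H1 H2]. apply (filter_inter _ Hp _ _ H1 H2).
      + intro H. apply (filter_proper _ HF). apply (filter_mono _ HF) with (2 := H).
        intros n. apply (filter_proper _ Hp).
    - intros A HA. unfold conv at 1.
      apply Hsub, (filter_mono _ HF) with (2 := HFF _ HA). intros n Hn.
      apply (filter_mono _ HF) with (2 := Hn). intros m.
      apply (filter_mono _ Hp). intro k. unfold shift. now rewrite Nat.add_assoc. }
  pose (F' := fun A' => exists A, p A /\ F (fun n => p (shift A n) -> A' n)).
  assert (Hsub' : subfamily F F').
  { intros A HA. exists (fun _ => True). split; [apply (filter_full _ Hp)|].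
    apply (filter_mono _ HF) with (2 := HA). auto. }
  assert (HF' : subfamily F' F).
  { apply Hmax; [|exact Hsub']. split.
    - split.
      + apply Hsub', (filter_full _ HF).
      + intros A B H [A0 [H1 H2]]. exists A0. split; [exact H1|].
        apply (filter_mono _ HF) with (2 := H2). auto.
      + intros A B [A0 [H1 H2]] [B0 [H3 H4]]. exists (fun n => A0 n /\ B0 n).
        split; [now apply filter_inter|].
        apply (filter_mono _ HF) with (2 := filter_inter _ HF _ _ H2 H4).
        intros n [H5 H6] H7. split.
        * apply H5, (filter_mono _ Hp) with (2 := H7). unfold shift; tauto.
        * apply H6, (filter_mono _ Hp) with (2 := H7). unfold shift; tauto.
      + intros [A [H1 H2]].
        (* If [F'] were improper, the complement of [A] would lie in [conv F p], hence in [F] and in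
           [p]. *)
        assert (H3 : p (fun n => ~ A n)).
        { apply HFp, Hconv, (filter_mono _ HF) with (2 := H2). intros n Hn.
          apply (ultrafilter_not _ _ Hpu Hn). }
        apply (filter_proper _ Hp).
        apply (filter_mono _ Hp) with (2 := filter_inter _ Hp _ _ H1 H3). tauto.
    - intros A' [A [H1 H2]]. exists A. split; [exact H1|].
      apply (filter_mono _ HF) with (2 := HFF _ H2). intros n H3 H4.
      exists (shift A n). split; [exact H4|].
      apply (filter_mono _ HF) with (2 := H3). intros m H5 H6. apply H5.
      apply (filter_mono _ Hp) with (2 := H6). intro k. unfold shift.
      now rewrite Nat.add_assoc. }
  split; [exact HF|]. intro A.
  (* For [B] in [p] the set of all [n] with [p (shift B n)] belongs to [F'], hence to [F], so [B] is
     in [conv F p]. Thus [F] is the ultrafilter [p]. *)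
  assert (HpF : subfamily p F).
  { intros B HB. apply Hconv, HF'. exists B. split; [exact HB|].
    apply (filter_mono _ HF) with (2 := filter_full _ HF). auto. }
  destruct Hpu as [_ Hpu]. destruct (Hpu A); auto.
Qed.

(** Idempotency passes to unions of chains, so there is a maximal idempotent filter above [F0].
    Extending [F0] places the idempotent in a prescribed closed semigroup. *)
Lemma idempotent_ultrafilter_extension F0 :
  idempotent_filter F0 ->
  exists u, ultrafilter u /\ subfamily u (conv u u) /\ subfamily F0 u.
Proof.
  intro HF0.
  destruct (maximal_extension idempotent_filter F0 HF0) as [u [Hu [H0 Hmax]]].
  - intros C HCne HC Hchain. split.
    + apply chain_union_filter; auto. intros F HF. now apply HC.
    + intros A [F [HF HA]]. exists F. split; [exact HF|].
      destruct (HC _ HF) as [HF1 HF2].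
      apply (filter_mono _ HF1) with (2 := HF2 _ HA). intros n Hn. now exists F.
  - exists u. split; [now apply maximal_idempotent_filter_ultra|]. split; [apply Hu|exact H0].
Qed.

(** * Limits in compact metric spaces *)

Lemma choice_function (A B : Type) (P : A -> B -> Prop) :
  (forall a, exists b, P a b) -> exists f : A -> B, forall a, P a (f a).
Proof.
  intro H.
  exists (fun a => proj1_sig (constructive_indefinite_description _ (H a))).
  intro a. apply proj2_sig.
Qed.

Lemma metric_refl X (d : X -> X -> R) x : is_metric d -> d x x = 0.
Proof. intros [_ [H _]]. now apply H. Qed.

Lemma metric_sym X (d : X -> X -> R) x y : is_metric d -> d x y = d y x.
Proof. intros [_ [_ [H _]]]. apply H. Qed.

Lemma metric_triangle X (d : X -> X -> R) x y z : is_metric d -> d x z <= d x y + d y z.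
Proof. intros [_ [_ [_ H]]]. apply H. Qed.

Lemma metric_pos X (d : X -> X -> R) x y : is_metric d -> x <> y -> 0 < d x y.
Proof.
  intros [H0 [H1 _]] H. destruct (H0 x y) as [|E]; [lra|].
  destruct H. apply H1. now symmetry.
Qed.

Lemma ball_open X (d : X -> X -> R) y r : is_metric d -> is_open d (fun w => d y w < r).
Proof.
  intros Hd x Hx. exists (r - d y x). split; [lra|]. intros w Hw.
  pose proof (metric_triangle _ d y x w Hd). lra.
Qed.

Lemma finite_ball_cover X (d : X -> X -> R) (r : X -> R) :
  is_metric d -> Defs.compact d -> (forall y, 0 < r y) ->
  exists l, forall w, exists y, In y l /\ d y w < r y.
Proof.
  intros Hd Hc Hr. apply (Hc X (fun y w => d y w < r y)).
  - intro y. now apply ball_open.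
  - intro x. exists x. rewrite metric_refl; auto.
Qed.

(** Without a cluster point every [y] has a ball missing some [W i]; finitely many such balls cover,
    and then [W k] is empty for a common later index [k]. The index set is a general directed one,
    to allow members of an ultrafilter and finite sets of points. *)
Lemma net_cluster X (d : X -> X -> R) (D : Type) (le : D -> D -> Prop) (W : D -> X -> Prop) :
  is_metric d -> Defs.compact d -> inhabited D ->
  (forall i j, exists k, le i k /\ le j k) ->
  (forall i j w, le i j -> W j w -> W i w) ->
  (forall i, exists w, W i w) ->
  exists y, forall i eps, 0 < eps -> exists w, W i w /\ d y w < eps.
Proof.
  intros Hd Hc [i0] Hdir Hanti Hne. apply NNPP. intro H.
  assert (H1 : forall y, exists p : D * R,
            0 < snd p /\ forall w, W (fst p) w -> ~ d y w < snd p).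
  { intro y. apply NNPP. intro H1. apply H. exists y. intros i eps Heps.
    apply NNPP. intro H2. apply H1. exists (i, eps). split; [exact Heps|].
    intros w Hw H3. apply H2. now exists w. }
  destruct (choice_function _ _ _ H1) as [f Hf].
  destruct (finite_ball_cover _ d (fun y => snd (f y)) Hd Hc) as [l Hl].
  { intro y. apply Hf. }
  assert (H2 : forall l', exists k, forall y w, In y l' -> W k w -> W (fst (f y)) w).
  { induction l' as [|y l' [k IH]].
    - exists i0. intros y w [].
    - destruct (Hdir k (fst (f y))) as [k' [H2 H3]]. exists k'.
      intros y' w [<-|Hy] Hw; eauto. }
  destruct (H2 l) as [k Hk]. destruct (Hne k) as [w Hw].
  destruct (Hl w) as [y [Hy Hyw]].
  apply (proj2 (Hf y) w); auto.
Qed.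

Definition ultralimit {X : Type} (d : X -> X -> R) (F : family) (s : nat -> X) (y : X) : Prop :=
  forall eps, 0 < eps -> F (fun n => d (s n) y < eps).

Lemma ultralimit_exists X (d : X -> X -> R) F (s : nat -> X) :
  is_metric d -> Defs.compact d -> ultrafilter F -> exists y, ultralimit d F s y.
Proof.
  intros Hd Hc HF. pose proof HF as [HF1 _].
  destruct (net_cluster X d {A | F A}
              (fun A B => forall n, proj1_sig B n -> proj1_sig A n)
              (fun A w => exists n, proj1_sig A n /\ s n = w)) as [y Hy]; auto.
  - constructor. exists (fun _ => True). now apply filter_full.
  - intros [A HA] [B HB]. exists (exist _ _ (filter_inter _ HF1 _ _ HA HB)).
    simpl. split; tauto.
  - intros A B w HAB [n [Hn Hw]]. exists n. auto.
  - intros [A HA]. destruct (filter_nonempty _ _ HF1 HA) as [n Hn]. exists (s n), n. auto.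
  - exists y. intros eps Heps. apply NNPP. intro H.
    destruct (Hy (exist _ _ (ultrafilter_not _ _ HF H)) eps Heps) as [w [[n [Hn <-]] Hw]].
    apply Hn. now rewrite metric_sym.
Qed.

(** * Recurrence in distal systems *)

Lemma iterate_add X (T : X -> X) m n x : iterate T (m + n) x = iterate T m (iterate T n x).
Proof. apply Nat.iter_add. Qed.

Lemma iterate_continuous X (d : X -> X -> R) T n :
  continuous_map d T -> continuous_map d (iterate T n).
Proof.
  intros HT. induction n as [|n IH]; intros x eps Heps.
  - exists eps. auto.
  - destruct (HT (iterate T n x) eps Heps) as [r [Hr H1]].
    destruct (IH x r Hr) as [r' [Hr' H2]]. exists r'. split; [exact Hr'|].
    intros y Hy. apply H1, H2, Hy.
Qed.

Lemma iterate_continuous_upto X (d : X -> X -> R) T M x eps :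
  continuous_map d T -> 0 < eps ->
  exists r, 0 < r /\ forall y, d x y < r ->
    forall n, (n <= M)%nat -> d (iterate T n x) (iterate T n y) < eps.
Proof.
  intros HT Heps. induction M as [|M [r [Hr IH]]].
  - exists eps. split; [exact Heps|]. intros y Hy n Hn. now replace n with 0%nat by lia.
  - destruct (iterate_continuous _ d T (S M) HT x eps Heps) as [r' [Hr' H]].
    exists (Rmin r r'). split; [now apply Rmin_pos|]. intros y Hy n Hn.
    pose proof (Rmin_l r r'). pose proof (Rmin_r r r').
    destruct (Nat.eq_dec n (S M)) as [->|Hne].
    + apply H. lra.
    + apply IH; [lra|lia].
Qed.

Lemma ultralimit_iterate X (d : X -> X -> R) T F (s : nat -> X) y l :
  is_metric d -> continuous_map d T -> is_filter F ->
  ultralimit d F s y -> ultralimit d F (fun n => iterate T l (s n)) (iterate T l y).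
Proof.
  intros Hd HT HF Hs eps Heps.
  destruct (iterate_continuous _ d T l HT y eps Heps) as [r [Hr H]].
  apply (filter_mono _ HF) with (2 := Hs r Hr). intros n Hn.
  rewrite (metric_sym _ d) by auto. apply H. now rewrite (metric_sym _ d).
Qed.

(* [f] and its limit [y] along an idempotent ultrafilter are proximal. *)
Lemma distal_idempotent_limit X (d : X -> X -> R) T u f :
  dynamical_system d T -> distal d T ->
  ultrafilter u -> subfamily u (conv u u) -> u (fun n => (1 <= n)%nat) ->
  ultralimit d u (fun n => iterate T n f) f.
Proof.
  intros [Hd [Hc HT]] Hdist Hu Huu Hu1. pose proof Hu as [Huf _].
  destruct (ultralimit_exists X d u (fun n => iterate T n f) Hd Hc Hu) as [y Hy].
  replace y with f in Hy; [exact Hy|].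
  apply Hdist. intros eps Heps.
  (* By idempotence the limit of [T^n y] is the iterated limit of [T^(n+m) f], which is [y] again;
     so [T^n f] and [T^n y] are near [y] for the same [n]. *)
  assert (Hy2 : u (fun n => d (iterate T n y) y < eps / 2)).
  { apply (filter_mono _ Huf) with (2 := Huu _ (Hy (eps / 4) ltac:(lra))).
    intros n Hn. unfold shift in Hn.
    destruct (filter_nonempty _ _ Huf
      (filter_inter _ Huf _ _ Hn
         (ultralimit_iterate _ d T u _ y n Hd HT Huf Hy (eps / 4) ltac:(lra)))) as [m [H1 H2]].
    simpl in *. rewrite iterate_add in H1. rewrite (metric_sym _ d) in H2 by auto.
    pose proof (metric_triangle _ d (iterate T n y) (iterate T n (iterate T m f)) y Hd). lra. }
  destruct (filter_nonempty _ _ Huf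
    (filter_inter _ Huf _ _ Hu1 (filter_inter _ Huf _ _ (Hy (eps / 2) ltac:(lra)) Hy2)))
    as [n [H1 [H2 H3]]].
  exists n. split; [exact H1|].
  rewrite (metric_sym _ d (iterate T n y)) in H3 by auto.
  pose proof (metric_triangle _ d (iterate T n f) y (iterate T n y) Hd). lra.
Qed.

(** Equicontinuity at every point of a compact space is uniform, by a Lebesgue number: with halved
    radii, a point near [z] lies in the same ball as [z]. *)
Lemma not_equicontinuous_point X (d : X -> X -> R) T :
  is_metric d -> Defs.compact d -> ~ equicontinuous d T ->
  exists x eps, 0 < eps /\ forall delta, 0 < delta ->
    exists z n, d x z < delta /\ eps <= d (iterate T n x) (iterate T n z).
Proof.
  intros Hd Hc Hne. apply NNPP. intro H. apply Hne. intros eps Heps.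
  assert (H1 : forall x, exists r, 0 < r /\ forall z, d x z < r ->
            forall n, d (iterate T n x) (iterate T n z) < eps / 2).
  { intro x. apply NNPP. intro H1. apply H. exists x, (eps / 2). split; [lra|].
    intros r Hr. apply NNPP. intro H2. apply H1. exists r. split; [exact Hr|].
    intros z Hz n. apply Rnot_le_lt. intro H3. apply H2. now exists z, n. }
  destruct (choice_function _ _ _ H1) as [r Hr].
  destruct (finite_ball_cover _ d (fun x => r x / 2) Hd Hc) as [l Hl].
  { intro y. pose proof (proj1 (Hr y)). lra. }
  assert (H2 : forall l', exists q, 0 < q /\ forall y, In y l' -> q <= r y / 2).
  { induction l' as [|y l' [q [Hq IH]]].
    - exists 1. split; [lra|intros y []].
    - exists (Rmin q (r y / 2)). pose proof (proj1 (Hr y)).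
      split; [apply Rmin_pos; lra|].
      pose proof (Rmin_l q (r y / 2)). pose proof (Rmin_r q (r y / 2)).
      intros y' [<-|Hy']; [lra|]. specialize (IH _ Hy'). lra. }
  destruct (H2 l) as [q [Hq Hql]]. exists q. split; [exact Hq|].
  intros z w Hzw n. destruct (Hl z) as [y [Hy Hyz]].
  specialize (Hql _ Hy). pose proof (metric_triangle _ d y z w Hd).
  pose proof (proj1 (Hr y)).
  pose proof (proj2 (Hr y) z ltac:(lra) n) as E1.
  pose proof (proj2 (Hr y) w ltac:(lra) n) as E2.
  rewrite (metric_sym _ d) in E1 by auto.
  pose proof (metric_triangle _ d (iterate T n z) (iterate T n y) (iterate T n w) Hd). lra.
Qed.

Lemma inv_INR_S_small delta : 0 < delta -> exists n, forall k, (n <= k)%nat -> / INR (S k) < delta.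
Proof.
  intro H. destruct (archimed_cor1 delta H) as [n [Hn Hpos]]. exists n. intros k Hk.
  apply Rle_lt_trans with (/ INR n); [|exact Hn].
  apply Rinv_le_contravar; [now apply lt_0_INR|]. apply le_INR. lia.
Qed.

Lemma inv_INR_S_pos n : 0 < / INR (S n).
Proof. apply Rinv_0_lt_compat, lt_0_INR. lia. Qed.

Lemma inv_INR_S_antitone m n : (m <= n)%nat -> / INR (S n) <= / INR (S m).
Proof.
  intro H. apply Rinv_le_contravar; [apply lt_0_INR; lia|apply le_INR; lia].
Qed.

Lemma distal_separated X (d : X -> X -> R) T a b :
  distal d T -> a <> b ->
  exists e, 0 < e /\ forall n, (1 <= n)%nat -> e <= d (iterate T n a) (iterate T n b).
Proof.
  intros Hdist Hab. apply NNPP. intro H. apply Hab, Hdist. intros e He.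
  apply NNPP. intro H1. apply H. exists e. split; [exact He|]. intros n Hn.
  apply Rnot_lt_le. intro H2. apply H1. now exists n.
Qed.

Lemma frechet_is_filter : is_filter (fun A => exists K, forall k, (K <= k)%nat -> A k).
Proof.
  split.
  - exists 0%nat. auto.
  - intros A B H [K HK]. exists K. auto.
  - intros A B [K HK] [K' HK']. exists (max K K'). intros k Hk. split; [apply HK|apply HK']; lia.
  - intros [K HK]. apply (HK K). lia.
Qed.

(* The filter of the left ideal of all [n + p-lim s], [n] in the remainder of the
   Stone-Cech compactification. *)
Lemma ideal_filter_idempotent p (s : nat -> nat) :
  is_filter p ->
  idempotent_filter (fun A => exists L, forall l, (L <= l)%nat -> p (fun k => A (l + s k)%nat)).
Proof.
  intro Hp. split; [split|].
  - exists 0%nat. intros _ _. now apply filter_full.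
  - intros A B H [L HL]. exists L. intros l Hl.
    apply (filter_mono _ Hp) with (2 := HL l Hl). auto.
  - intros A B [L HL] [L' HL']. exists (max L L'). intros l Hl.
    apply (filter_inter _ Hp); [apply HL|apply HL']; lia.
  - intros [L HL]. apply (filter_proper _ Hp), (HL L). lia.
  - intros A [L HL]. exists L. intros l Hl.
    (* Every [l + s k + j] is at least [L], so [HL] applies to it whatever [k] and [j] are. *)
    apply (filter_mono _ Hp) with (2 := filter_full _ Hp). intros k _.
    exists 0%nat. intros j _.
    apply (filter_mono _ Hp) with (2 := HL (l + s k + j)%nat ltac:(lia)).
    intro i. unfold shift. now rewrite Nat.add_assoc.
Qed.

(** The time is [m = l + n_k]: the [n_k] carry [x] and [x_k] towards distinct points [a] and [b],
    distality keeps [T^l a] and [T^l b] apart, and [l] is chosen so that [m] is a return time of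
    [F], a set of times large for the idempotent [u]. *)
Lemma distal_separating_times X (d : X -> X -> R) T :
  dynamical_system d T -> distal d T -> ~ equicontinuous d T ->
  exists x e, 0 < e /\ forall (F : list X) delta B, 0 < delta ->
    exists m z, (B <= m)%nat /\ d z x < delta /\
      e <= d (iterate T m z) (iterate T m x) /\
      forall f, In f F -> d (iterate T m f) f < delta.
Proof.
  intros HXT Hdist Hne. pose proof HXT as [Hd [Hc HT]].
  destruct (not_equicontinuous_point X d T Hd Hc Hne) as [x [eps [Heps Hx]]].
  assert (H1 : forall k, exists q : X * nat, d x (fst q) < / INR (S k) /\
            eps <= d (iterate T (snd q) x) (iterate T (snd q) (fst q))).
  { intro k. destruct (Hx _ (inv_INR_S_pos k)) as [z [n H]]. now exists (z, n). }
  destruct (choice_function _ _ _ H1) as [q Hq].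
  pose (xs := fun k => fst (q k)). pose (ns := fun k => snd (q k)).
  destruct (ultrafilter_extension _ frechet_is_filter) as [p [Hp Hfr]].
  pose proof Hp as [Hpf _].
  destruct (ultralimit_exists X d p (fun k => iterate T (ns k) x) Hd Hc Hp) as [a Ha].
  destruct (ultralimit_exists X d p (fun k => iterate T (ns k) (xs k)) Hd Hc Hp) as [b Hb].
  assert (Hab : a <> b).
  { intros <-.
    destruct (filter_nonempty _ _ Hpf (filter_inter _ Hpf _ _
       (Ha (eps / 2) ltac:(lra)) (Hb (eps / 2) ltac:(lra)))) as [k [H2 H3]].
    destruct (Hq k) as [_ H4]. fold (ns k) (xs k) in H4.
    rewrite (metric_sym _ d _ a) in H3 by auto.
    pose proof (metric_triangle _ d (iterate T (ns k) x) a (iterate T (ns k) (xs k)) Hd). lra. }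
  destruct (distal_separated X d T a b Hdist Hab) as [e [He Hsep]].
  destruct (idempotent_ultrafilter_extension _ (ideal_filter_idempotent p ns Hpf))
    as [u [Hu [Huu HGu]]].
  pose proof Hu as [Huf _].
  assert (Hu1 : u (fun n => (1 <= n)%nat)).
  { apply HGu. exists 1%nat. intros l Hl.
    apply (filter_mono _ Hpf) with (2 := filter_full _ Hpf). intros; lia. }
  exists x, (e / 2). split; [lra|]. intros F delta B Hdelta.
  assert (HA : u (fun n => True /\ forall f, In f F -> d (iterate T n f) f < delta)).
  { apply (filter_forall_mem u (fun _ => True) X F (fun f n => d (iterate T n f) f < delta) Huf).
    - now apply filter_full.
    - intros f _. now apply (distal_idempotent_limit X d T u f). }
  set (A := fun n => _) in HA.
  (* Otherwise the complement of [A] would be in the ideal filter, hence in [u]. The bound [S B]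
     also ensures [1 <= l], from where on distality separates orbits. *)
  assert (Hl : exists l, (S B <= l)%nat /\ p (fun k => A (l + ns k)%nat)).
  { apply NNPP. intro H. apply (filter_proper _ Huf).
    apply (filter_mono _ Huf) with (A := fun n => A n /\ ~ A n); [tauto|].
    apply (filter_inter _ Huf); [exact HA|]. apply HGu. exists (S B). intros l Hl.
    apply (ultrafilter_not _ _ Hp). intro H2. apply H. now exists l. }
  destruct Hl as [l [HBl Hl]].
  assert (Hxs : p (fun k => d (xs k) x < delta)).
  { apply Hfr. destruct (inv_INR_S_small delta Hdelta) as [K HK]. exists K. intros k Hk.
    rewrite (metric_sym _ d) by auto. destruct (Hq k) as [H2 _].
    specialize (HK k Hk). unfold xs. lra. }
  destruct (filter_nonempty _ _ Hpf (filter_inter _ Hpf _ _ Hl (filter_inter _ Hpf _ _ Hxs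
    (filter_inter _ Hpf _ _ (ultralimit_iterate _ d T p _ a l Hd HT Hpf Ha (e / 4) ltac:(lra))
       (ultralimit_iterate _ d T p _ b l Hd HT Hpf Hb (e / 4) ltac:(lra))))))
    as [k [[_ H2] [H3 [H4 H5]]]].
  exists (l + ns k)%nat, (xs k). split; [lia|]. split; [exact H3|]. split; [|exact H2].
  rewrite !iterate_add.
  specialize (Hsep l ltac:(lia)). simpl in H4, H5.
  set (a' := iterate T l a) in *. set (b' := iterate T l b) in *.
  set (v := iterate T l (iterate T (ns k) x)) in *.
  set (w := iterate T l (iterate T (ns k) (xs k))) in *.
  rewrite (metric_sym _ d v) in H4 by auto. rewrite (metric_sym _ d w v) by auto.
  pose proof (metric_triangle _ d a' v b' Hd). pose proof (metric_triangle _ d v w b' Hd). lra.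
Qed.

(** * Toggles *)

Definition toggles {X : Type} (d : X -> X -> R) (T : X -> X) (x y : X) : Prop :=
  forall (F : list X) delta B, 0 < delta ->
    exists m z, (B <= m)%nat /\ d z x < delta /\ d (iterate T m z) y < delta /\
      forall f, In f F -> d (iterate T m f) f < delta.

(** [y] is a cluster point of the images [T^m z] as the finite set grows, with one [n] serving as
    time bound and as tolerance [1/(n+1)]. It differs from [x]: once [x] is in the finite set,
    [T^m x] is near [x] while [T^m z] stays [e] away from [T^m x]. *)
Lemma distal_toggles X (d : X -> X -> R) T :
  dynamical_system d T -> distal d T -> ~ equicontinuous d T ->
  exists x y, x <> y /\ toggles d T x y.
Proof.
  intros HXT Hdist Hne. pose proof HXT as [Hd [Hc HT]].
  destruct (distal_separating_times X d T HXT Hdist Hne) as [x [e [He Hx]]].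
  destruct (net_cluster X d (list X * nat)
    (fun i j => incl (fst i) (fst j) /\ (snd i <= snd j)%nat)
    (fun i w => exists m z, (snd i <= m)%nat /\ d z x < / INR (S (snd i)) /\
       iterate T m z = w /\ e <= d w (iterate T m x) /\
       forall f, In f (fst i) -> d (iterate T m f) f < / INR (S (snd i)))) as [y Hy]; auto.
  - constructor. exact (nil, 0%nat).
  - intros [F n] [F' n']. exists (F ++ F', max n n'). simpl.
    repeat split; try lia; [apply incl_appl|apply incl_appr]; apply incl_refl.
  - intros [F n] [F' n'] w [HF Hn] [m [z [H1 [H2 [H3 [H4 H5]]]]]]. cbn [fst snd] in *.
    pose proof (inv_INR_S_antitone _ _ Hn).
    exists m, z. repeat split; auto; [lia|lra|].
    intros f Hf. specialize (H5 f (HF f Hf)). lra.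
  - intros [F n]. destruct (Hx F (/ INR (S n)) n (inv_INR_S_pos n)) as [m [z H]].
    exists (iterate T m z), m, z. cbn [fst snd]. tauto.
  - exists x, y. split.
    + intros <-. destruct (inv_INR_S_small (e / 2) ltac:(lra)) as [n Hn].
      specialize (Hn n (le_n n)).
      destruct (Hy (x :: nil, n) (e / 2) ltac:(lra)) as [w [[m [z [_ [_ [_ [H1 H2]]]]]] H3]].
      cbn [fst snd] in H2. specialize (H2 x (or_introl eq_refl)).
      rewrite (metric_sym _ d x) in H3 by auto.
      rewrite (metric_sym _ d _ x) in H2 by auto.
      pose proof (metric_triangle _ d w x (iterate T m x) Hd). lra.
    + intros F delta B Hdelta. destruct (inv_INR_S_small delta Hdelta) as [n Hn].
      specialize (Hn (max n B) ltac:(lia)).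
      destruct (Hy (F, max n B) delta Hdelta) as [w [[m [z [H1 [H2 [H3 [_ H4]]]]]] H5]].
      cbn [fst snd] in *. exists m, z. repeat split; [lia|lra| |].
      * rewrite H3, (metric_sym _ d) by auto. exact H5.
      * intros f Hf. specialize (H4 f Hf). lra.
Qed.

(** * Independence sets *)

Fixpoint subsum (m : nat -> nat) (S : nat -> bool) (n : nat) : nat :=
  match n with
  | O => 0
  | Datatypes.S k => subsum m S k + (if S k then m k else 0)
  end.

Lemma subsum_ext m m' S n :
  (forall k, (k < n)%nat -> m k = m' k) -> subsum m S n = subsum m' S n.
Proof.
  induction n as [|n IH]; intro H; [reflexivity|]. simpl.
  rewrite IH by (intros; apply H; lia). now rewrite (H n) by lia.
Qed.

Lemma subsum_le_full m S n : (subsum m S n <= subsum m (fun _ => true) n)%nat.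
Proof. induction n as [|n IH]; simpl; [lia|]. destruct (S n); lia. Qed.

Lemma subsum_mono m S n n' : (n <= n')%nat -> (subsum m S n <= subsum m S n')%nat.
Proof. induction 1; simpl; lia. Qed.

(** Induction on the number of toggles, each chosen after the earlier ones with a much smaller
    tolerance. That all partial sums nearly fix [x] and [y] is carried along so that a new point can
    be followed through the old toggles. *)
Lemma toggle_sums X (d : X -> X -> R) T x y :
  is_metric d -> continuous_map d T -> toggles d T x y ->
  forall N B eps, 0 < eps ->
  exists (m : nat -> nat) (z : nat -> X),
    (forall k, (k < N)%nat -> (B <= m k /\ subsum m (fun _ => true) k < m k)%nat) /\
    forall S, d (iterate T (subsum m S N) x) x < eps /\
      d (iterate T (subsum m S N) y) y < eps /\
      forall i, (i < N)%nat ->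
        d (iterate T (subsum m S N) (z i)) (if S i then y else x) < eps.
Proof.
  intros Hd HT Htog. induction N as [|N IH]; intros B eps Heps.
  - exists (fun _ => 0%nat), (fun _ => x). split; [lia|]. intro S. simpl.
    rewrite !metric_refl by auto. repeat split; [exact Heps|exact Heps|lia].
  - destruct (IH B (eps / 2) ltac:(lra)) as [m [z [Hm HS]]].
    set (M := subsum m (fun _ => true) N).
    destruct (iterate_continuous_upto X d T M x (eps / 2) HT ltac:(lra)) as [rx [Hrx Hcx]].
    destruct (iterate_continuous_upto X d T M y (eps / 2) HT ltac:(lra)) as [ry [Hry Hcy]].
    pose (delta := Rmin (eps / 2) (Rmin rx ry)).
    assert (Hdelta : 0 < delta /\ delta <= eps / 2 /\ delta <= rx /\ delta <= ry).
    { unfold delta. pose proof (Rmin_l (eps / 2) (Rmin rx ry)).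
      pose proof (Rmin_r (eps / 2) (Rmin rx ry)).
      pose proof (Rmin_l rx ry). pose proof (Rmin_r rx ry).
      repeat split; try lra. repeat apply Rmin_pos; lra. }
    destruct Hdelta as [Hdelta [Hd1 [Hd2 Hd3]]].
    (* All positions that [x], [y] and the old [z i] can reach under old sums; the new toggle must
       nearly fix them. *)
    pose (F := flat_map (fun w => map (fun s => iterate T s w) (seq 0 (S M)))
                 (x :: y :: map z (seq 0 N))).
    assert (HF : forall s w, (s <= M)%nat -> In w (x :: y :: map z (seq 0 N)) ->
              In (iterate T s w) F).
    { intros s w Hs Hw. apply in_flat_map. exists w. split; [exact Hw|].
      apply in_map_iff. exists s. split; [reflexivity|]. apply in_seq. lia. }
    (* The bound [S M] makes the new time exceed the sum of all earlier ones. *)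
    destruct (Htog F delta (max B (S M)) Hdelta) as [mN [zN [HmN [HzN [HmzN HFN]]]]].
    pose (m' := fun k => if k =? N then mN else m k).
    pose (z' := fun k => if k =? N then zN else z k).
    assert (Em : forall k, (k < N)%nat -> m' k = m k).
    { intros k Hk. unfold m'. destruct (Nat.eqb_spec k N); [lia|reflexivity]. }
    assert (Ez : forall k, (k < N)%nat -> z' k = z k).
    { intros k Hk. unfold z'. destruct (Nat.eqb_spec k N); [lia|reflexivity]. }
    assert (EmN : m' N = mN) by (unfold m'; now rewrite Nat.eqb_refl).
    assert (EzN : z' N = zN) by (unfold z'; now rewrite Nat.eqb_refl).
    assert (Es : forall S k, (k <= N)%nat -> subsum m' S k = subsum m S k).
    { intros S k Hk. apply subsum_ext. intros j Hj. apply Em. lia. }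
    exists m', z'. split.
    + intros k Hk. rewrite Es by lia. destruct (Nat.eq_dec k N) as [->|Hne].
      * rewrite EmN. fold M. lia.
      * rewrite Em by lia. apply Hm. lia.
    + intro S. destruct (HS S) as [Hx [Hy Hz]].
      assert (HsM : (subsum m S N <= M)%nat) by apply subsum_le_full.
      simpl. rewrite Es, EmN by lia. set (s := subsum m S N) in *.
      (* For old points the new toggle acts last and adds an error below [eps / 2]. *)
      assert (Hstep : forall w t, In w (x :: y :: map z (seq 0 N)) ->
                d (iterate T s w) t < eps / 2 ->
                d (iterate T (s + (if S N then mN else 0)) w) t < eps).
      { intros w t Hw Ht. destruct (S N); [|rewrite Nat.add_0_r; lra].
        rewrite Nat.add_comm, iterate_add.
        pose proof (HFN _ (HF s w HsM Hw)).
        pose proof (metric_triangle _ d (iterate T mN (iterate T s w)) (iterate T s w) t Hd).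
        lra. }
      split; [apply Hstep; [now left|exact Hx]|].
      split; [apply Hstep; [right; now left|exact Hy]|].
      intros i Hi. destruct (Nat.eq_dec i N) as [->|Hne].
      (* For the new point it acts first, if at all; then [T^s] is applied near [y] or near [x],
         where continuity controls it. *)
      * rewrite EzN. destruct (S N).
        -- rewrite iterate_add.
           rewrite (metric_sym _ d _ y) in HmzN by auto.
           specialize (Hcy (iterate T mN zN) ltac:(lra) s HsM).
           rewrite (metric_sym _ d) in Hcy by auto.
           pose proof (metric_triangle _ d (iterate T s (iterate T mN zN)) (iterate T s y) y Hd).
           lra.
        -- rewrite Nat.add_0_r.
           rewrite (metric_sym _ d _ x) in HzN by auto.
           specialize (Hcx zN ltac:(lra) s HsM).
           rewrite (metric_sym _ d) in Hcx by auto.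
           pose proof (metric_triangle _ d (iterate T s zN) (iterate T s x) x Hd). lra.
      * rewrite Ez by lia. apply Hstep; [|apply Hz; lia].
        right; right. apply in_map, in_seq. lia.
Qed.

(** The binary digits of [i] enumerate all 0-1 patterns of length [n]. *)
Definition independence_times {X : Type} (d : X -> X -> R) (T : X -> X) (x y : X)
    (eps : R) (n : nat) (t : nat -> nat) : Prop :=
  exists z : nat -> X, forall i j, (i < 2 ^ n)%nat -> (j < n)%nat ->
    d (iterate T (t j) (z i)) (if Nat.testbit i j then y else x) < eps.

(* The summands with index below [2 ^ n] produce the patterns, the last [n]
   summands only make the times increasing. *)
Lemma toggles_independence X (d : X -> X -> R) T x y :
  is_metric d -> continuous_map d T -> toggles d T x y ->
  forall n B eps, 0 < eps ->
  exists t, (forall j, (j < n)%nat -> (B <= t j)%nat) /\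
    (forall j, (S j < n)%nat -> (t j < t (S j))%nat) /\
    independence_times d T x y eps n t.
Proof.
  intros Hd HT Htog n B eps Heps.
  destruct (toggle_sums X d T x y Hd HT Htog (2 ^ n + n) B eps Heps) as [m [z [Hm HS]]].
  pose (Q := fun j k => if k <? 2 ^ n then Nat.testbit k j else k - 2 ^ n =? j).
  pose (t := fun j => subsum m (Q j) (2 ^ n + n)).
  (* The largest summand of [t j] is [m (2 ^ n + j)]. It exceeds the sum of all earlier terms, so
     [t] is ordered by these last summands. *)
  assert (Hlow : forall j, (j < n)%nat -> (m (2 ^ n + j) <= t j)%nat).
  { intros j Hj. unfold t.
    apply Nat.le_trans with (subsum m (Q j) (S (2 ^ n + j))); [|apply subsum_mono; lia].
    cbn [subsum].
    replace (Q j (2 ^ n + j)%nat) with true; [lia|]. unfold Q.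
    destruct (Nat.ltb_spec (2 ^ n + j) (2 ^ n)); [lia|]. symmetry. apply Nat.eqb_eq. lia. }
  assert (Hup : forall j, (j < n)%nat ->
            (t j <= subsum m (fun _ => true) (S (2 ^ n + j)))%nat).
  { intros j Hj.
    assert (H : forall r, subsum m (Q j) (S (2 ^ n + j) + r)%nat = subsum m (Q j) (S (2 ^ n + j))).
    { induction r as [|r IH]; [now rewrite Nat.add_0_r|].
      rewrite Nat.add_succ_r. cbn [subsum] in *. rewrite IH.
      replace (Q j (S (2 ^ n + j) + r)%nat) with false; [lia|]. unfold Q.
      destruct (Nat.ltb_spec (S (2 ^ n + j) + r) (2 ^ n)); [lia|]. symmetry.
      apply Nat.eqb_neq. lia. }
    unfold t. replace (2 ^ n + n)%nat with (S (2 ^ n + j) + (n - S j))%nat by lia.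
    rewrite H. apply subsum_le_full. }
  exists t. split; [|split].
  - intros j Hj. specialize (Hlow j Hj). specialize (Hm (2 ^ n + j)%nat ltac:(lia)). lia.
  - intros j Hj. specialize (Hlow _ Hj). specialize (Hup j ltac:(lia)).
    specialize (Hm (2 ^ n + S j)%nat ltac:(lia)).
    replace (S (2 ^ n + j)) with (2 ^ n + S j)%nat in Hup by lia. lia.
  - exists z. intros i j Hi Hj. destruct (HS (Q j)) as [_ [_ H]].
    specialize (H i ltac:(lia)). unfold Q in H at 2.
    destruct (Nat.ltb_spec i (2 ^ n)); [exact H|lia].
Qed.

(** Block [b] fills the positions from [2^b - 1] to [2^(b+1) - 2], more than half of all positions
    up to its end; hence its patterns alone force a positive growth rate. *)
Lemma toggles_independence_sequence X (d : X -> X -> R) T x y eps :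
  is_metric d -> continuous_map d T -> toggles d T x y -> 0 < eps ->
  exists t, increasing_seq t /\
    forall b, independence_times d T x y eps (2 ^ b) (fun j => t (2 ^ b - 1 + j)%nat).
Proof.
  intros Hd HT Htog Heps.
  destruct (choice_function (nat * nat) (nat -> nat) (fun p t =>
      (forall j, (j < fst p)%nat -> (snd p <= t j)%nat) /\
      (forall j, (S j < fst p)%nat -> (t j < t (S j))%nat) /\
      independence_times d T x y eps (fst p) t)) as [f Hf].
  { intros [n B]. now apply toggles_independence. }
  (* Block [b + 1] starts after the last time of block [b]. *)
  pose (bound := nat_rect (fun _ => nat) 0%nat
                   (fun b B => S (f (2 ^ b, B)%nat (2 ^ b - 1)%nat))).
  (* Writing [S j = 2^b + r] with [r < 2^b], position [j] is entry [r] of block [b]. *)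
  pose (t := fun j => let b := Nat.log2 (S j) in f (2 ^ b, bound b)%nat (S j - 2 ^ b)%nat).
  assert (Ht : forall b j, (j < 2 ^ b)%nat -> t (2 ^ b - 1 + j)%nat = f (2 ^ b, bound b)%nat j).
  { intros b j Hj. unfold t.
    replace (S (2 ^ b - 1 + j)) with (2 ^ b + j)%nat by lia.
    rewrite (Nat.log2_unique (2 ^ b + j) b); [f_equal; lia|lia|].
    rewrite Nat.pow_succ_r'. lia. }
  exists t. split.
  - intro i. destruct (Nat.log2_spec (S i) ltac:(lia)) as [H1 H2].
    set (b := Nat.log2 (S i)) in *. rewrite Nat.pow_succ_r' in H2.
    destruct (Hf (2 ^ b, bound b)%nat) as [_ [Hinc _]]. cbn [fst snd] in Hinc.
    pose (j := (S i - 2 ^ b)%nat).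
    replace i with (2 ^ b - 1 + j)%nat by (unfold j; lia).
    assert (Hj : (j < 2 ^ b)%nat) by (unfold j; lia). rewrite (Ht b j Hj).
    destruct (le_lt_dec (2 ^ b) (S j)) as [Hlast|Hlt].
    + replace (S (2 ^ b - 1 + j)) with (2 ^ (S b) - 1 + 0)%nat
        by (rewrite Nat.pow_succ_r'; lia).
      rewrite Ht by (rewrite Nat.pow_succ_r'; lia).
      destruct (Hf (2 ^ S b, bound (S b))%nat) as [Hlow _]. cbn [fst snd] in Hlow.
      specialize (Hlow 0%nat ltac:(rewrite Nat.pow_succ_r'; lia)).
      replace j with (2 ^ b - 1)%nat by lia.
      change (bound (S b)) with (S (f (2 ^ b, bound b)%nat (2 ^ b - 1)%nat)) in *. lia.
    + replace (S (2 ^ b - 1 + j)) with (2 ^ b - 1 + S j)%nat by lia.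
      rewrite Ht by lia. now apply Hinc.
  - intro b. destruct (Hf (2 ^ b, bound b)%nat) as [_ [_ [z Hz]]]. cbn [fst snd] in Hz.
    exists z. intros i j Hi Hj. rewrite Ht by exact Hj. now apply Hz.
Qed.

(** * Sequence entropy *)

Lemma join_subcover_exists X (T : X -> X) (U : list (X -> Prop)) t n :
  (forall x, exists V, In V U /\ V x) -> exists k, join_subcover_card T U t n k.
Proof.
  intro HU. induction n as [|n [k [cs [_ [Hcs Hcov]]]]].
  - exists 1%nat, ((fun _ _ => True) :: nil). repeat split; [lia|].
    intro x. exists (fun _ _ => True). split; [now left|lia].
  - pose (cs' := flat_map (fun c => map (fun V i => if i =? n then V else c i) U) cs).
    exists (length cs'), cs'. split; [reflexivity|]. split.
    + intros c Hc i Hi. apply in_flat_map in Hc. destruct Hc as [c0 [H1 H2]].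
      apply in_map_iff in H2. destruct H2 as [V [<- HV]].
      destruct (Nat.eqb_spec i n); [exact HV|]. apply Hcs; [exact H1|lia].
    + intro x. destruct (Hcov x) as [c [Hc Hx]].
      destruct (HU (iterate T (t n) x)) as [V [HV HVx]].
      exists (fun i => if i =? n then V else c i). split.
      * apply in_flat_map. exists c. split; [exact Hc|].
        apply in_map_iff. now exists V.
      * intros i Hi. destruct (Nat.eqb_spec i n) as [->|Hne]; [exact HVx|]. apply Hx. lia.
Qed.

(** The [epsilon] in [N_join] is meaningful because some finite subcover exists and [nat] is
    well-ordered. *)
Lemma N_join_card X (T : X -> X) (U : list (X -> Prop)) t n :
  (forall x, exists V, In V U /\ V x) -> join_subcover_card T U t n (N_join T U t n).
Proof.
  intro HU. unfold N_join.
  apply (epsilon_spec (inhabits 0%nat) (is_min_nat (join_subcover_card T U t n))).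
  destruct (join_subcover_exists X T U t n HU) as [k Hk].
  destruct (dec_inh_nat_subset_has_unique_least_element (join_subcover_card T U t n))
    as [k0 [H _]].
  - intro j. apply classic.
  - now exists k.
  - now exists k0.
Qed.

(** Choosing a partner for every index gives an injection into [l]; the element [a0] is the default
    beyond [n]. *)
Lemma functional_relation_length (A : Type) (l : list A) (P : A -> nat -> Prop) n :
  (forall i, (i < n)%nat -> exists a, In a l /\ P a i) ->
  (forall a i i', P a i -> P a i' -> i = i') -> (n <= length l)%nat.
Proof.
  intros Hex Hfun.
  destruct n as [|n]; [lia|]. destruct (Hex 0%nat ltac:(lia)) as [a0 _].
  destruct (choice_function nat A (fun i a => (i < S n)%nat -> In a l /\ P a i)) as [f Hf].
  { intro i. destruct (le_lt_dec (S n) i); [exists a0; lia|].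
    destruct (Hex i ltac:(lia)) as [a Ha]. now exists a. }
  replace (S n) with (length (map f (seq 0 (S n))))
    by now rewrite length_map, length_seq.
  apply NoDup_incl_length.
  - apply NoDup_map_NoDup_ForallPairs; [|apply seq_NoDup].
    intros i i' Hi Hi' E. apply in_seq in Hi, Hi'.
    apply (Hfun (f i)); [apply Hf; lia|]. rewrite E. apply Hf. lia.
  - intros a Ha. apply in_map_iff in Ha. destruct Ha as [i [<- Hi]].
    apply in_seq in Hi. apply Hf. lia.
Qed.

Lemma testbit_inj_pow2 L i i' :
  (i < 2 ^ L)%nat -> (i' < 2 ^ L)%nat ->
  (forall j, (j < L)%nat -> Nat.testbit i j = Nat.testbit i' j) -> i = i'.
Proof.
  intros Hi Hi' H. apply Nat.bits_inj. intro j.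
  destruct (le_lt_dec L j) as [Hj|Hj]; [|now apply H].
  rewrite <- (Nat.mod_small i (2 ^ L)), <- (Nat.mod_small i' (2 ^ L)) by assumption.
  now rewrite !Nat.mod_pow2_bits_high by assumption.
Qed.

(** The complement of a closed ball; two of these around distant centres form the open cover. *)
Definition far {X : Type} (d : X -> X -> R) (x : X) (eps : R) : X -> Prop :=
  fun w => eps < d w x.

Lemma far_open X (d : X -> X -> R) x eps : is_metric d -> is_open d (far d x eps).
Proof.
  intros Hd w Hw. unfold far in *. exists (d w x - eps). split; [lra|]. intros v Hv.
  pose proof (metric_triangle _ d w v x Hd). lra.
Qed.

(* A bit pattern is read off an element [c] of the join: a point near [y] at time [t j]
   avoids [far d y eps] there, so [c j] must be [far d x eps], and vice versa. *)
Lemma independence_join_card X (d : X -> X -> R) T x y eps t s L n k :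
  independence_times d T x y eps L (fun j => t (s + j)%nat) -> (s + L <= n)%nat ->
  join_subcover_card T (far d x eps :: far d y eps :: nil) t n k -> (2 ^ L <= k)%nat.
Proof.
  intros [z Hz] Hn [cs [<- [Hcs Hcov]]].
  apply (functional_relation_length _ cs (fun c i => (i < 2 ^ L)%nat /\
    forall j, (j < L)%nat -> Nat.testbit i j = true <-> c (s + j)%nat = far d x eps)).
  - intros i Hi. destruct (Hcov (z i)) as [c [Hc Hci]]. exists c.
    split; [exact Hc|]. split; [exact Hi|]. intros j Hj.
    specialize (Hz i j Hi Hj). specialize (Hci (s + j)%nat ltac:(lia)).
    specialize (Hcs c Hc (s + j)%nat ltac:(lia)).
    destruct (Nat.testbit i j); split; intro H; try easy.
    + destruct Hcs as [<-|[E|[]]]; [reflexivity|].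
      rewrite <- E in Hci. unfold far in Hci. lra.
    + rewrite H in Hci. unfold far in Hci. lra.
  - intros c i i' [Hi H] [Hi' H']. apply (testbit_inj_pow2 L); auto.
    intros j Hj. apply Bool.eq_iff_eq_true. rewrite H, H' by exact Hj. reflexivity.
Qed.

Lemma toggles_not_null X (d : X -> X -> R) T x y :
  is_metric d -> continuous_map d T -> x <> y -> toggles d T x y -> ~ null d T.
Proof.
  intros Hd HT Hxy Htog Hnull.
  pose proof (metric_pos _ d x y Hd Hxy) as Hpos.
  (* Below half the distance, so that no point is within [eps] of both [x] and [y]. *)
  set (eps := d x y / 3).
  destruct (toggles_independence_sequence X d T x y eps Hd HT Htog) as [t [Hinc Ht]].
  { unfold eps; lra. }
  set (U := far d x eps :: far d y eps :: nil).
  assert (HU : finite_open_cover d U).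
  { split.
    - intros V [<-|[<-|[]]]; now apply far_open.
    - intro w. destruct (Rlt_le_dec eps (d w x)) as [H|H].
      + exists (far d x eps). split; [now left|exact H].
      + exists (far d y eps). split; [right; now left|]. unfold far.
        pose proof (metric_triangle _ d x w y Hd).
        rewrite (metric_sym _ d x w) in H0 by auto. unfold eps in *. lra. }
  pose proof ln_lt_2 as Hln.
  destruct (Hnull t Hinc U HU) as [Hlim _].
  destruct (Hlim (ln 2 / 4) ltac:(lra)) as [n0 Hn0].
  (* The end of block [n0]: at least [2^(2^n0)] sets are needed while [n < 2 * 2^n0], so the rate
     exceeds [ln 2 / 2], contradicting the bound [ln 2 / 4]. *)
  pose (n := (2 ^ n0 - 1 + 2 ^ n0)%nat).
  assert (Hlt : (n0 < 2 ^ n0)%nat) by (apply Nat.pow_gt_lin_r; lia).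
  specialize (Hn0 n ltac:(unfold n; lia)).
  pose proof (independence_join_card X d T x y eps t _ (2 ^ n0) n _ (Ht n0) (le_n n)
                (N_join_card X T U t n (proj2 HU))) as Hcard.
  fold U in Hcard. set (N := N_join T U t n) in *.
  assert (HN : INR (2 ^ n0) * ln 2 <= ln (INR N)).
  { apply le_INR in Hcard. rewrite pow_INR in Hcard.
    change (INR 2) with 2 in Hcard. rewrite <- ln_pow by lra.
    destruct Hcard as [Hcard| ->]; [left|right; reflexivity].
    apply ln_increasing; [apply pow_lt; lra|exact Hcard]. }
  assert (Hn : 0 < INR n) by (apply lt_0_INR; unfold n; lia).
  assert (Hn2 : INR n < 2 * INR (2 ^ n0)).
  { change 2 with (INR 2) at 1. rewrite <- mult_INR. apply lt_INR. unfold n. lia. }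
  apply (Rmult_le_compat_r (INR n)) in Hn0; [|lra].
  unfold Rdiv in Hn0 at 1. rewrite Rmult_assoc, Rinv_l, Rmult_1_r in Hn0 by lra.
  nra.
Qed.

Theorem mainTheorem4 (X : Type) (d : X -> X -> R) (T : X -> X) :
  dynamical_system d T -> distal d T -> null d T -> equicontinuous d T.
Proof.
  intros HXT Hdist Hnull. apply NNPP. intro Hne.
  destruct (distal_toggles X d T HXT Hdist Hne) as [x [y [Hxy Htog]]].
  destruct HXT as [Hd [_ HT]].
  exact (toggles_not_null X d T x y Hd HT Hxy Htog Hnull).
Qed.
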